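(* Let $P$ be a parity complex which satisfies the relevance axiom and the torsion-freeness axiom. Then $P$ is a torsion-free complex.
   Context: An $\omega$-hypergraph is a set $P$ with a partition $P=\bigsqcup_{n\in\mathbb{N}}P_n$ together with, for $n\in\mathbb{N}$ and $u\in P_{n+1}$, two finite subsets $u^-,u^+\subseteq P_n$. For $U\subseteq P$ and $\epsilon\in\{-,+\}$, $U^\epsilon=\bigcup_{u\in U}u^\epsilon$; also $u^{\epsilon\eta}=(u^\epsilon)^\eta$, $U^\mp=U^-\setminus U^+$ and $U^\pm=U^+\setminus U^-$. A subset $U\subseteq P_n$ is fork-free if either $n=0$ and $|U|=1$, or $n>0$ and $u^\epsilon\cap v^\epsilon=\emptyset$ for all distinct $u,v\in U$ and all $\epsilon\in\{-,+\}$. For $U\subseteq P_n$, $\triangleleft_U$ is the transitive closure of the relation on $U$ relating $u$ to $v$ when $n\ge 1$ and $u^+\cap v^-\neq\emptyset$; for $V,W\subseteq U$, $V\triangleleft_U W$ means $v\triangleleft_U w$ for some $v\in V$, $w\in W$; a subset $V\subseteq U$ is a segment for $\triangleleft_U$ if $u_1,u_3\in V$ and $u_1\triangleleft_U u_2\triangleleft_U u_3$ imply $u_2\in V$. For $u,v\in P$, $u\triangleleft v$ means $u,v\in P_n$ and $u\triangleleft_{P_n}v$ for some $n\geq1$. $P$ is acyclic if $\triangleleft$ is irreflexive. An $n$-pre-cell of $P$ is a tuple $X=(X_{0,-},X_{0,+},\ldots,X_{n-1,-},X_{n-1,+},X_n)$ of finite subsets $X_{i,\epsilon}\subseteq P_i$,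 $X_n\subseteq P_n$; one writes $X_{n,-}=X_{n,+}=X_n$. A finite set $M\subseteq P_{i+1}$ moves a finite $U\subseteq P_i$ to a finite $V\subseteq P_i$ if $U=(V\cup M^-)\setminus M^+$ and $V=(U\cup M^+)\setminus M^-$. An $n$-cell is an $n$-pre-cell such that $X_{i+1,\epsilon}$ moves $X_{i,-}$ to $X_{i,+}$ for $0\le i<n$, $\epsilon\in\{-,+\}$, and every $X_{i,\epsilon}$ ($0\le i\le n$) is fork-free. For $u\in P_n$, the atom $\langle u\rangle$ is the $n$-pre-cell with $\langle u\rangle_{n,-}=\langle u\rangle_{n,+}=\{u\}$ and, for $j<n$, $\langle u\rangle_{j,-}=(\langle u\rangle_{j+1,-})^\mp$, $\langle u\rangle_{j,+}=(\langle u\rangle_{j+1,+})^\pm$. A subset $U\subseteq P_n$ is tight if for all $u,v\in P_n$ with $u\triangleleft v$ and $v\in U$, $u^-\cap U^\pm=\emptyset$. A parity complex is an $\omega$-hypergraph $P$ such that: (0) $u^-\neq\emptyset$ and $u^+\ne\emptyset$ for $u\in P_n$, $n\geq1$; (1) $u^{--}\cup u^{++}=u^{-+}\cup u^{+-}$ for $u\in P_n$, $n\ge2$; (2) $u^-$ and $u^+$ are fork-free for $u\in P_n$, $n\geq1$; (3) $P$ is acyclic; (4) for $n\ge1$, $u,v\in P_n$, $w\in P_{n+1}$, if $u\triangleleft v$, $u\in w^\epsilon$ and $v\in w^\eta$ with $\epsilon,\eta\in\{-,+\}$, then $\epsilon=\eta$; (5) for $i<n$ and $u\in P_n$, $\langle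 u\rangle_{i,-}$ is tight. A torsion-free complex is an $\omega$-hypergraph $P$ satisfying: (non-emptiness) $u^-\ne\emptyset$ and $u^+\neq\emptyset$ for all $u\in P_n$, $n\ge1$; (acyclicity) $P$ is acyclic; (relevance) $\langle u\rangle$ is a cell for all $u\in P$; (segment) for all $k\in\mathbb N$, $u\in P_k$, $n<k$, every $n$-cell $X$ and $\epsilon\in\{-,+\}$, if $\langle u\rangle_{n,\epsilon}\subseteq X_n$ then $\langle u\rangle_{n,\epsilon}$ is a segment for $\triangleleft_{X_n}$; (torsion-freeness) there are no $n,k,l\ge1$ with $n<\min(k,l)$, $u\in P_k$, $v\in P_l$ and $n$-cell $X$ with $\langle u\rangle_{n,+}\subseteq X_n$, $\langle v\rangle_{n,-}\subseteq X_n$, $\langle u\rangle_{n,+}\cap\langle v\rangle_{n,-}=\emptyset$, $\langle u\rangle_{n,+}\triangleleft_{X_n}\langle v\rangle_{n,-}$ and $\langle v\rangle_{n,-}\triangleleft_{X_n}\langle u\rangle_{n,+}$. *)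

(* Defs.v *)
From Stdlib Require Import Relation_Operators.
From mathcomp Require Import all_boot.
From mathcomp Require Import boolp classical_sets cardinality.

Set Implicit Arguments.
Unset Strict Implicit.
Unset Printing Implicit Defensive.

Local Open Scope classical_set_scope.

Inductive sign := minus | plus.

Definition opp (e : sign) : sign := if e is minus then plus else minus.

(** The partition of the carrier is given by [dim]: the block P_n is
    [grade P n] below.  The field [dim_face] also makes the faces of an element
    of dimension 0 empty, which is how [face e u] is totalized. *)
Record hypergraph := Hypergraph {
  elt :> Type;
  dim : elt -> nat;
  face : sign -> elt -> set elt;
  dim_face : forall e u v, face e u v -> dim u = (dim v).+1;
  finite_face : forall e u, finite_set (face e u)
}.

Section Definitions.
Variable P : hypergraph.
Implicit Types (n i : nat) (e : sign) (u v w : P) (U V W M : set P).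

Definition grade n : set P := [set u | dim u = n].

(** U^e *)
Definition faces e U : set P := \bigcup_(u in U) face e u.

(** U^{-+} (minus over plus) for [e = minus], and U^{+-} (plus over minus) for
    [e = plus]: the e-faces that are not faces of the opposite sign. *)
Definition border e U : set P := faces e U `\` faces (opp e) U.

(** Used for [U] included in [grade P n]. *)
Definition fork_free n U : Prop :=
  (n = 0 /\ exists u, U = [set u]) \/
  (0 < n /\ forall u v e, U u -> U v -> u <> v ->
     face e u `&` face e v = set0).

(** [tri U] is the relation u <|_U v.  No condition on the dimension is needed,
    as faces of elements of dimension 0 are empty. *)
Definition tri U : P -> P -> Prop :=
  clos_trans P
    (fun u v => [/\ U u, U v & face plus u `&` face minus v !=set0]).

Definition tri_set U V W : Prop :=
  exists v w, [/\ V v, W w & tri U v w].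

(** Used for [V] included in [U]. *)
Definition segment U V : Prop :=
  forall u1 u2 u3, V u1 -> V u3 -> tri U u1 u2 -> tri U u2 u3 -> V u2.

(** The relation u <| v, without subscript. *)
Definition prec u v : Prop :=
  exists n, [/\ 1 <= n, grade n u, grade n v & tri (grade n) u v].

Definition acyclic : Prop := forall u, ~ prec u u.

(** A tuple (X_{0,-}, X_{0,+}, ..., X_n) is encoded by a function which is empty
    beyond [n], with X_{n,-} = X_{n,+} = X_n. *)
Definition precell n (X : nat -> sign -> set P) : Prop :=
  [/\ forall i e, i <= n -> X i e `<=` grade i /\ finite_set (X i e),
      X n minus = X n plus
    & forall i e, n < i -> X i e = set0].

Definition moves M U V : Prop :=
  U = (V `|` faces minus M) `\` faces plus M /\
  V = (U `|` faces plus M) `\` faces minus M.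

Definition cell n (X : nat -> sign -> set P) : Prop :=
  [/\ precell n X,
      forall i e, i < n -> moves (X i.+1 e) (X i minus) (X i plus)
    & forall i e, i <= n -> fork_free i (X i e)].

(** Unfolds to [set u] at i = dim u and to [border e (atom u i.+1 e)] at
    i < dim u (see [atom_dim] and [atom_lt]). *)
Definition atom u i e : set P :=
  if i <= dim u then iter (dim u - i) (border e) [set u] else set0.

(** Used for [U] included in some [grade P n], which then contains [u], since
    [prec u v] forces [u] and [v] to have the same dimension. *)
Definition tight U : Prop :=
  forall u v, prec u v -> U v -> face minus u `&` border plus U = set0.

Definition non_emptiness : Prop :=
  forall n u, 1 <= n -> grade n u ->
    face minus u !=set0 /\ face plus u !=set0.

Definition relevance : Prop := forall u, cell (dim u) (atom u).

Definition segment_axiom : Prop :=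
  forall k u n X e, grade k u -> n < k -> cell n X ->
    atom u n e `<=` X n minus -> segment (X n minus) (atom u n e).

Definition torsion_freeness : Prop :=
  ~ exists n k l u v X,
      [/\ [/\ 1 <= n, 1 <= k, 1 <= l & n < minn k l],
          [/\ grade k u, grade l v & cell n X],
          [/\ atom u n plus `<=` X n minus,
              atom v n minus `<=` X n minus
            & atom u n plus `&` atom v n minus = set0],
          tri_set (X n minus) (atom u n plus) (atom v n minus)
        & tri_set (X n minus) (atom v n minus) (atom u n plus)].

Record parity_complex : Prop := ParityComplex {
  parity_non_empty : non_emptiness;
  parity_globular : forall n u, 2 <= n -> grade n u ->
    faces minus (face minus u) `|` faces plus (face plus u) =
    faces plus (face minus u) `|` faces minus (face plus u);
  parity_fork_free : forall n u e, grade n.+1 u -> fork_free n (face e u);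
  parity_acyclic : acyclic;
  parity_sign : forall n u v w e f, 1 <= n ->
    grade n u -> grade n v -> grade n.+1 w ->
    prec u v -> face e w u -> face f w v -> e = f;
  parity_tight : forall i n u, i < n -> grade n u -> tight (atom u i minus)
}.

Record torsion_free_complex : Prop := TorsionFreeComplex {
  tf_non_empty : non_emptiness;
  tf_acyclic : acyclic;
  tf_relevance : relevance;
  tf_segment : segment_axiom;
  tf_torsion_free : torsion_freeness
}.

Lemma atom_dim u e : atom u (dim u) e = [set u].
Proof. by rewrite /atom leqnn subnn. Qed.

Lemma atom_lt u i e (lt_iu : i < dim u) : atom u i e = border e (atom u i.+1 e).
Proof. by rewrite /atom lt_iu (ltnW lt_iu) -(subnSK lt_iu). Qed.

Lemma atom_precell u : precell (dim u) (atom u).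
Proof.
split=> [i e|| i e lt_ui]; last 2 first.
- by rewrite !atom_dim.
- by rewrite /atom leqNgt lt_ui.
move=> le_iu; rewrite -(subKn le_iu); move: (leq_subr i (dim u)).
elim: (dim u - i) => [_|k IHk lt_ku].
  by rewrite subn0 atom_dim; split=> [_ ->//|]; exact: finite_set1.
have [sub fin] := IHk (ltnW lt_ku).
have lt_iu : dim u - k.+1 < dim u by rewrite subnSK ?leq_subr.
rewrite (atom_lt _ lt_iu) subnSK //.
split=> [v [[w /sub dw wv] _]|].
  by move: (dim_face wv); rewrite dw -(subnSK lt_ku) => -[].
apply: finite_setD; apply: bigcup_finite => // w _; exact: finite_face.
Qed.

End Definitions.

(* Main.v *)
(** Only the segment axiom has to be proved.  Suppose that a path of [X n] leaves
    [atom u n e] through a face [a] and later comes back through a face [b].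
    By fork-freeness of [X n], the face [a] lies in the target border, and [b] in
    the source border, of [atom u n e].  As the atom of [u] is a cell, these are
    also borders of [atom u n minus], so the path from [a] to [b] contradicts
    the tightness of [atom u n minus], whichever the sign [e] is. *)
From Stdlib Require Import Relation_Operators Operators_Properties.
From mathcomp Require Import all_boot.
From mathcomp Require Import boolp classical_sets.
Require Import Defs.

Set Implicit Arguments.
Unset Strict Implicit.
Unset Printing Implicit Defensive.

Local Open Scope classical_set_scope.

Lemma clos_trans_exit (T : Type) (R : T -> T -> Prop) (A : T -> Prop) x y :
  clos_trans T R x y -> A x -> ~ A y ->
  exists v w, [/\ A v, ~ A w, R v w, clos_refl_trans T R x v
                & clos_refl_trans T R w y].
Proof.
elim=> {x y} [x y Rxy Ax nAy|x y z Rxy IHxy Ryz IHyz Ax nAz].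
  by exists x, y; split=> //; apply: rt_refl.
have [Ay|nAy] := pselect (A y).
  have [v [w [Av nAw Rvw yv wz]]] := IHyz Ay nAz.
  exists v, w; split=> //; apply: rt_trans yv; exact: clos_t_clos_rt.
have [v [w [Av nAw Rvw xv wy]]] := IHxy Ax nAy.
exists v, w; split=> //; apply: rt_trans wy _; exact: clos_t_clos_rt.
Qed.

Lemma clos_refl_trans_sub (T : Type) (R S : T -> T -> Prop) x y :
  (forall u v, R u v -> S u v) ->
  clos_refl_trans T R x y -> clos_refl_trans T S x y.
Proof.
move=> RS; elim=> {x y} [x y /RS|x|x y z _ Sxy _ Syz].
- exact: rt_step.
- exact: rt_refl.
- exact: rt_trans Sxy Syz.
Qed.

Lemma tri_grade0 (P : hypergraph) (U : set P) u v :
  U `<=` grade 0 -> ~ tri U u v.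
Proof.
move=> U0; elim=> // {}u {}v [/U0 du _ [a [ua _]]].
by have := dim_face ua; rewrite du.
Qed.

(** For [n = m.+1], [atom u n e] moves [atom u m minus] to [atom u m plus], so its source border
    lies in [atom u m minus], which is by construction the source border of [atom u n minus]. *)
Lemma border_minus_atom (P : hypergraph) (u : P) n e :
  relevance P -> n < dim u -> 0 < n ->
  border minus (atom u n e) `<=` border minus (atom u n minus).
Proof.
case: n => // n relP ltn _ a [aM naM]; have [_ mov _] := relP u.
have [src _] := mov n e (ltnW ltn).
by rewrite -(atom_lt _ (ltnW ltn)) src; split; [right|].
Qed.

Lemma border_plus_atom (P : hypergraph) (u : P) n e :
  relevance P -> n < dim u -> 0 < n ->
  border plus (atom u n e) `<=` border plus (atom u n minus).
Proof.
case: n => // n relP ltn _ a [aM naM]; have [_ mov _] := relP u.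
have [_ tgt_e] := mov n e (ltnW ltn).
have [_ tgt] := mov n minus (ltnW ltn).
have : atom u n plus a by rewrite tgt_e; split; [right|].
(* Here [n] is already the predecessor. Elements of [atom u n minus] are minus faces of
   [atom u n.+1 minus], so the move removes them and only new plus faces remain. *)
rewrite tgt (atom_lt minus (ltnW ltn)) => -[[[]|] //].
Qed.

(** By fork-freeness, [w] is the only element of [V] with [a] in its face of sign [opp e]. *)
Lemma border_fork_free (P : hypergraph) n (U V : set P) e v w a :
  0 < n -> fork_free n V -> U `<=` V -> U v -> V w -> ~ U w ->
  face e v a -> face (opp e) w a -> border e U a.
Proof.
move=> n0 [[n00]|[_ ffV] UV Uv Vw nUw va wa]; first by rewrite n00 in n0.
split=> [|[w' Uw' w'a]]; first by exists v.
have ww' : w <> w' by move=> ww'; apply: nUw; rewrite ww'.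
by have : set0 a by rewrite -(ffV w w' (opp e) Vw (UV _ Uw') ww').
Qed.

Lemma parity_segment (P : hypergraph) :
  parity_complex P -> relevance P -> segment_axiom P.
Proof.
move=> parP relP k u n X e uk ltnk cX AX u1 u2 u3 A1 A3 t12 t23.
have [[/(_ n minus (leqnn n)) [Xn _] _ _] _ /(_ n minus (leqnn n)) ffX] := cX.
have ltnu : n < dim u by rewrite uk.
case: (posnP n) => [n0|n0].
  by move: Xn; rewrite n0 => X0; rewrite n0 in t12; case: (tri_grade0 X0 t12).
apply: contrapT => nA2.
have [x [y [Ax nAy [_ Xy [a [xa ya]]] _ y2]]] := clos_trans_exit t12 A1 nA2.
have nnA3 : ~ ~ atom u n e u3 by apply.
(* Leaving the complement of the atom is the return to it, found on the rest of the path, from [y]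
   to [u3]. *)
have [y' [z [nAy' /contrapT Az [Xy' _ [b [y'b zb]]] yy' _]]] :=
  clos_trans_exit (A := fun v => ~ atom u n e v) (clos_rt_t _ _ _ _ _ y2 t23)
    nAy nnA3.
have ba := border_plus_atom relP ltnu n0
  (border_fork_free (e := plus) n0 ffX AX Ax Xy nAy xa ya).
(* Tightness concerns [atom u n minus], whereas [z] is in [atom u n e]; so [z] is traded for an
   element [z'] of the former with the same source face [b]. *)
have [[z' Az' z'b] _] := border_minus_atom relP ltnu n0
  (border_fork_free (e := minus) n0 ffX AX Az Xy' nAy' zb y'b).
have Pz' : grade n z'.
  have [sub _ _] := atom_precell u.
  by have [+ _] := sub n minus (ltnW ltnu); apply.
have yz' : prec y z'.
  exists n; split=> //; first exact: Xn.
  (* The path is widened from [X n] to [grade n], since [z'] need not lie in [X n]. *)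
  apply: (clos_rt_t _ _ _ y'); last first.
    by apply: t_step; split=> //; [exact: Xn|exists b].
  apply: clos_refl_trans_sub yy' => v w [/Xn Pv /Xn Pw vw]; by split.
have := parity_tight parP ltnu (erefl (dim u)) yz' Az'.
by move=> empty; have : set0 a by rewrite -empty.
Qed.

Theorem mainTheorem7 (P : hypergraph) :
  parity_complex P -> relevance P -> torsion_freeness P ->
  torsion_free_complex P.
Proof.
move=> parP relP torP; split=> //.
- exact: parity_non_empty.
- exact: parity_acyclic.
- exact: parity_segment.
Qed.
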